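(* Let $(a_j)_{j\ge1}$, $(b_j)_{j\ge1}$ be increasing sequences of real numbers with $a_j<b_j$, $a_j\sim j$, $b_j\sim j$, and $b_j-a_j\gg1$. Let $X=\prod_{j\ge1}[a_j,b_j]=\{\mathcal{N}=(n_j)_{j\ge1}: a_j\le n_j\le b_j\}$ (sequences need not be non-decreasing). Equip $X$ with (i) the product topology $\tau_\Pi$, and (ii) the metric $d(\mathcal{N}_1,\mathcal{N}_2)=\sup_{j\ge1}\frac{|n_{1,j}-n_{2,j}|}{b_j-a_j}$ for $\mathcal{N}_i=(n_{i,j})_{j\ge1}$. Let $F(x,t)$ be a complex-valued function which is right-continuous in $x$, and let $$Y(F)=\Bigl\{\mathcal{N}\in X:\ \exists x_0>1,\ \exists\, 0<c_1<1<c_2,\ \exists\,\eta\in[0,1)\ \text{such that}\ \Bigl|\sum_{n_j\le x}n_j^{-\mathrm{i} t}-F(x,t)\Bigr|\le\eta x\ \text{for all } x\ge x_0 \text{ and } t \text{ with } x^{c_1}\le|t|\le x^{c_2}\Bigr\}.$$ Then $Y(F)$ is a meagre subset of $X$ both with respect to $\tau_\Pi$ and with respect to the topology induced by $d$.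
   Context: A subset of a topological space is meagre (of first category) if it is a countable union of nowhere dense sets. *)

(* Defs.v *)
From HB Require Import structures.
From mathcomp Require Import all_boot all_order all_algebra.
From mathcomp Require Import all_classical all_reals all_analysis.
From mathcomp Require Import complex.
Set Implicit Arguments.
Unset Strict Implicit.
Unset Printing Implicit Defensive.
Import Order.TTheory GRing.Theory Num.Theory.
Import numFieldNormedType.Exports.
Local Open Scope classical_set_scope.
Local Open Scope ring_scope.
Local Open Scope complex_scope.

Definition nowhere_dense (T : topologicalType) (A : set T) : Prop :=
  interior (closure A) = set0.

Definition meagre (T : topologicalType) (A : set T) : Prop :=
  exists2 B : nat -> set T,
    forall k, nowhere_dense (B k) & A = \bigcup_k B k.

(* Sequences indexed by j >= 1 are encoded as functions on nat, the value at
   i : nat being the term of index j = i.+1. *)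

(* Vinogradov's b_j - a_j >> 1. *)
Definition gap_bounded_below (R : realType) (a b : nat -> R) : Prop :=
  exists2 c : R, 0 < c & forall i, c <= b i - a i.

Definition seq_box (R : realType) (a b : nat -> R) : Type :=
  prod_topology (fun i : nat => set_type `[a i, b i]).

HB.instance Definition _ (R : realType) (a b : nat -> R) :=
  Topological.on (seq_box a b).

Definition box_dist (R : realType) (a b : nat -> R) (M N : seq_box a b) : R :=
  sup (range (fun i => `|set_val (M i) - set_val (N i)| / (b i - a i))).

(* X with the topology of the metric box_dist; this is a metric because
   a_j < b_j, hence the proof argument. *)
Definition metric_box (R : realType) (a b : nat -> R)
  (ab : forall i, a i < b i) : Type := seq_box a b.

Section metric_box.
Context (R : realType) (a b : nat -> R) (ab : forall i, a i < b i).
Implicit Types M N P : seq_box a b.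

Let quot (M N : seq_box a b) i :=
  `|set_val (M i) - set_val (N i)| / (b i - a i).

Let gap_gt0 i : 0 < b i - a i. Proof. by rewrite subr_gt0. Qed.

Let quot_le1 M N i : quot M N i <= 1.
Proof.
rewrite /quot ler_pdivrMr// mul1r.
have := set_valP (M i); have := set_valP (N i).
rewrite /= !in_itv/= => /andP[ay yb] /andP[ax xb].
by rewrite ler_norml opprB !lerB.
Qed.

Let quot_has_sup M N : has_sup (range (quot M N)).
Proof.
split; first by exists (quot M N 0%N); exists 0%N.
by exists 1 => _ [i _ <-]; exact: quot_le1.
Qed.

Let quot_le_dist M N i : quot M N i <= box_dist M N.
Proof. by apply: (ub_le_sup (quot_has_sup M N).2); exists i. Qed.

Let dist_le M N e : (forall i, quot M N i <= e) -> box_dist M N <= e.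
Proof.
move=> h; apply: ge_sup; first exact: (quot_has_sup M N).1.
by move=> _ [i _ <-]; exact: h.
Qed.

Let quot_ge0 M N i : 0 <= quot M N i.
Proof. by rewrite /quot divr_ge0// ltW. Qed.

Let distxx M : box_dist M M = 0.
Proof.
apply/eqP; rewrite eq_le (le_trans (quot_ge0 M M 0%N) (quot_le_dist _ _ _)) andbT.
by apply: dist_le => i; rewrite /quot subrr normr0 mul0r.
Qed.

Let dist_positivity M N : box_dist M N = 0 -> M = N.
Proof.
move=> d0; apply: functional_extensionality_dep => i; apply/val_inj/eqP.
rewrite -subr_eq0 -normr_le0.
have := quot_le_dist M N i; rewrite d0 /quot ler_pdivrMr// mul0r.
exact.
Qed.

Let dist_sym M N : box_dist M N = box_dist N M.
Proof.
by rewrite /box_dist; under eq_fun do rewrite distrC.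
Qed.

Let dist_triangle N M P : box_dist M P <= box_dist M N + box_dist N P.
Proof.
apply: dist_le => i; apply: le_trans (lerD (quot_le_dist M N i) (quot_le_dist N P i)).
by rewrite /quot -mulrDl ler_pM2r ?invr_gt0// ler_distD.
Qed.

HB.instance Definition _ := Choice.copy (metric_box ab) (seq_box a b).
HB.instance Definition _ := @isMetric.Build R (metric_box ab)
  (@box_dist R a b) distxx dist_positivity dist_sym dist_triangle.

End metric_box.

Definition expC (R : realType) (z : R[i]) : R[i] :=
  (expR (complex.Re z) * cos (complex.Im z))
    +i* (expR (complex.Re z) * sin (complex.Im z)).

(* x ^ s for x > 0; for x <= 0 the library's [ln x = 0] makes the value 1. *)
Definition powRC (R : realType) (x : R) (s : R[i]) : R[i] := expC (s * (ln x)%:C).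

(* When [N i] tends to infinity with i, as it does if a_j ~ j, the index set
   below is finite and this is the sum of n_j^{-it} over n_j <= x. *)
Definition nit_sum (R : realType) (a b : nat -> R) (N : seq_box a b) (x t : R)
    : R[i] :=
  \sum_(i \in [set i | set_val (N i) <= x]) powRC (set_val (N i)) (0 -i* t).

(* Only x > 1 is ever used, so F is unconstrained elsewhere.  [R[i]^o] carries
   the topology of the modulus. *)
Definition right_continuous_fst (R : realType) (F : R -> R -> R[i]) : Prop :=
  forall x t : R, 1 < x -> (F y t : R[i]^o) @[y --> x^'+] --> (F x t : R[i]^o).

Definition Y (R : realType) (a b : nat -> R) (F : R -> R -> R[i])
    : set (seq_box a b) :=
  [set N | exists x0 c1 c2 eta : R,
    [/\ 1 < x0, 0 < c1 < 1, 1 < c2, 0 <= eta < 1 &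
      forall x t : R, x0 <= x -> x `^ c1 <= `|t| <= x `^ c2 ->
        `|nit_sum N x t - F x t| <= (eta * x)%:C]].

(* Main.v *)
Require Import Defs.
From HB Require Import structures.
From mathcomp Require Import all_boot all_order all_algebra.
From mathcomp Require Import all_classical all_reals all_analysis.
From mathcomp Require Import complex ring lra.
Import Order.TTheory GRing.Theory Num.Theory.
Import numFieldNormedType.Exports.
Local Open Scope classical_set_scope.
Local Open Scope ring_scope.
Local Open Scope complex_scope.

(** Put [t = x ^ c] with [c > 1].  Near a number of size at most [x] the phase
    [t * ln y] turns through a full circle on an interval of length
    [2 * pi * x / t], which tends to 0.  So if [x = b_n] is large, every
    sequence [N] can be moved by less than any prescribed amount in the metric
    [d] so that the terms [n_j ^ (-it)] with [j0 <= j < n] all become 1,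
    and also so that they all become -1, the other terms being the same in both cases.
    The two sums differ by [2 * (n - j0)], which exceeds [2 * eta * x] because
    [b_j ~ j]; hence one of them is at distance more than [eta * x] from
    [F x t].  Keeping the moved terms away from [x] (where the summation
    condition jumps) and from 0 (where [ln] does) makes the sum continuous at
    that point for the product topology, so the violation persists on a product
    neighbourhood.  The metric topology is finer than the product topology, so
    this settles both at once, with [eta] and [c] running through countable
    families. *)

Set Implicit Arguments.
Unset Strict Implicit.
Unset Printing Implicit Defensive.

(** * Comparison of the product and metric topologies on the box *)

Section box_topology.
Context (R : realType) (a b : nat -> R) (ab : forall i, a i < b i).
Implicit Types M N : seq_box a b.

Lemma box_itv M i : a i <= set_val (M i) <= b i.
Proof. by have := set_valP (M i); rewrite /= in_itv. Qed.

Lemma box_dist_ge M N i :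
  `|set_val (M i) - set_val (N i)| <= box_dist M N * (b i - a i).
Proof.
rewrite -ler_pdivrMr ?subr_gt0//; apply: ub_le_sup; last by exists i.
exists 1 => _ [j _ <-]; rewrite ler_pdivrMr ?subr_gt0// mul1r.
have /andP[aM Mb] := box_itv M j; have /andP[aN Nb] := box_itv N j.
by rewrite ler_norml opprB !lerB.
Qed.

Lemma box_dist_le M N e :
  (forall i, `|set_val (M i) - set_val (N i)| <= e * (b i - a i)) ->
  box_dist M N <= e.
Proof.
move=> h; apply: ge_sup; first by eexists; exists 0%N.
by move=> _ [i _ <-]; rewrite ler_pdivrMr ?subr_gt0.
Qed.

Lemma nbhs_metric_boxP N (A : set (seq_box a b)) :
  nbhs (N : metric_box ab) A <->
  exists2 e, 0 < e & forall M, box_dist N M < e -> A M.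
Proof.
rewrite -nbhs_ballE; split=> -[e e0 h]; exists e => // M;
  by have := h M; rewrite ballEmdist.
Qed.

Lemma nbhs_box_metric N (A : set (seq_box a b)) :
  nbhs N A -> nbhs (N : metric_box ab) A.
Proof.
suff : nbhs (N : metric_box ab) --> N by exact.
(* The product topology is the supremum of the initial topologies of the coordinates, so one open
   condition on one coordinate suffices. *)
apply/cvg_sup => i B [_ [[_ [V Vo <-] <-]] VN] VB.
have [e/= e0 eV] : nbhs (set_val (N i)) V by exact: open_nbhs_nbhs.
apply/nbhs_metric_boxP; exists (e / (b i - a i)).
  by rewrite divr_gt0 ?subr_gt0.
move=> M; rewrite ltr_pdivlMr ?subr_gt0// => NM; apply: VB; apply: eV => /=.
exact: le_lt_trans (box_dist_ge _ _ _) NM.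
Qed.

Lemma box_coord_continuous N i :
  (set_val (M i) : R) @[M --> N] --> (set_val (N i) : R).
Proof.
apply: (@continuous_comp _ _ _ (fun M : seq_box a b => M i) set_val).
  exact: (@proj_continuous _ _ i N).
exact: initial_continuous.
Qed.

(** The hypothesis takes the stronger option twice: [M] is close to [N] in the metric, yet a whole
    product neighbourhood of [M] misses [B k]. It therefore refutes interior points of the closure
    in either topology. *)
Lemma meagre_box (A : set (seq_box a b)) (B : nat -> set (seq_box a b)) :
  A `<=` \bigcup_k B k ->
  (forall k N e, 0 < e -> exists2 M, box_dist N M < e &
    \forall P \near M, ~ B k P) ->
  meagre A /\ meagre (A : set (metric_box ab)).
Proof.
(* [meagre] asks for an equality, so the covering sets are cut down to [A]. *)
move=> AB escape; have eqA : A = \bigcup_k (A `&` B k).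
  by rewrite -setI_bigcupr; apply/esym/setIidl.
split; exists (fun k => A `&` B k) => // k; rewrite /nowhere_dense -subset0.
- move=> N /nbhs_box_metric /nbhs_metric_boxP[e e0 /= eN].
  have [M NM MB] := escape k N e e0.
  by have [P [[_ BP] /(_ BP)]] := eN M NM _ MB.
- move=> N /nbhs_metric_boxP[e e0 /= eN].
  have [M NM /nbhs_box_metric MB] := escape k N e e0.
  by have [P [[_ BP] /(_ BP)]] := eN M NM _ MB.
Qed.

End box_topology.

(** * Prescribing the phase inside a short interval *)

Section tuning.
Context {R : realType}.
Implicit Types u v t th : R.

Lemma ln_sub_ge u v : 0 < u -> 0 < v -> (v - u) / v <= ln v - ln u.
Proof.
move=> u0 v0; have uv0 : 0 < u / v by rewrite divr_gt0.
rewrite -[leLHS]opprK -[leRHS]opprK lerN2 opprB -ln_div ?posrE//.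
rewrite -mulNr opprB mulrBl divff ?gt_eqF// lerBrDl.
by apply: le_trans (expR_ge1Dx _) _; rewrite lnK ?posrE.
Qed.

(** By [ln_sub_ge], [t * ln y] grows by at least a full turn between [u] and [v], so it meets the
    class of [th] modulo [2 * pi]. *)
Lemma cos_ln_attained u v t th : 1 <= u -> u <= v -> 0 < t ->
  pi *+ 2 * v <= t * (v - u) -> th <= pi *+ 2 ->
  exists2 y, u <= y <= v & cos (t * ln y) = cos th.
Proof.
move=> u1 uv t0 vut th2.
have p0 : 0 < pi *+ 2 :> R by rewrite mulrn_wgt0// pi_gt0.
have u0 : 0 < u := lt_le_trans ltr01 u1.
have v0 : 0 < v := lt_le_trans u0 uv.
(* With [m] the integer part of [z], [th + 2 * pi * m] lies in the turn that starts at [t * ln u].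
   The bounds [1 <= u] and [th <= 2 * pi] give [0 <= z], so a natural [m] will do. *)
pose z := (t * ln u - th) / (pi *+ 2) + 1.
have tlnu : 0 <= t * ln u by rewrite mulr_ge0 ?ln_ge0 ?(ltW t0).
have z0 : 0 <= z.
  by rewrite /z -(divff (lt0r_neq0 p0)) -mulrDl divr_ge0 ?(ltW p0)//; lra.
have /andP[] := truncn_itv z0; set m := Num.truncn z => mz zm.
have zE : (z - 1) * (pi *+ 2) = t * ln u - th.
  by rewrite /z addrK divfK// gt_eqF.
have lnuv : pi *+ 2 <= t * (ln v - ln u).
  apply: le_trans (_ : t * ((v - u) / v) <= _); last first.
    by rewrite ler_pM2l// ln_sub_ge.
  by rewrite mulrA ler_pdivlMr.
have {}zm : z - 1 < m%:R by move: zm; rewrite -natr1; lra.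
have ztm : t * ln u - th <= (pi *+ 2) * m%:R.
  by rewrite -zE mulrC ler_pM2l// ltW.
have mzt : (pi *+ 2) * m%:R <= t * ln u - th + pi *+ 2.
  by rewrite -zE mulrBl mul1r subrK mulrC ler_pM2r.
exists (expR ((th + pi *+ 2 *+ m) / t)); last first.
  rewrite expRK mulrC divfK ?gt_eqF//.
  exact: (periodicn (@cosD2pi R)).
have wE : pi *+ 2 *+ m = pi *+ 2 * m%:R :> R by rewrite mulr_natr.
rewrite -[X in X <= _ <= _]lnK ?posrE// -[X in _ <= _ <= X]lnK ?posrE//.
rewrite !ler_expR ler_pdivlMr// ler_pdivrMr// wE ![_ * t]mulrC.
by apply/andP; split; lra.
Qed.

End tuning.

(** * The real part of the sum and its continuity *)

Section cosine_sum.
Context (R : realType) (a b : nat -> R).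
Implicit Types N : seq_box a b.

Definition cos_term (x t y : R) : R := if y <= x then cos (t * ln y) else 0.

(** From index [K] on, every admissible term exceeds [x]; the same finite range thus serves all [N],
    which makes continuity in [N] a coordinatewise matter. *)
Lemma Re_nit_sum N x t K : (forall i, (K <= i)%N -> x < a i) ->
  complex.Re (nit_sum N x t) = \sum_(i < K) cos_term x t (set_val (N i)).
Proof.
move=> Kx; rewrite /nit_sum.
have -> : [set i | set_val (N i) <= x] =
    `I_K `&` [set i | set_val (N i) <= x].
  apply/esym/setIidr => i /= Nix; rewrite ltnNge; apply/negP => /Kx.
  by rewrite ltNge (le_trans _ Nix)//; have /andP[] := box_itv N i.
rewrite fsbig_mkcondr -(fsbig_ord _ K (fun i => if i \in _ then _ else _)).
rewrite raddf_sum; apply: eq_bigr => i _ /=.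
rewrite /cos_term; case: ifPn => [/set_mem/= -> | /negP h].
  rewrite /= !mulr0 !mul0r subr0 expR0 mul1r.
  by rewrite add0r mulNr cosN.
by rewrite ifF//; apply/negP => h'; apply/h/mem_set.
Qed.

Lemma cos_term_continuous (x t y : R) : y != 0 -> y != x ->
  {for y, continuous (cos_term x t)}.
Proof.
move=> y0 yx; have [xy|{}yx] : x < y \/ y < x.
- by apply/orP; rewrite -neq_lt eq_sym.
- have yE : cos_term x t y = 0 by rewrite /cos_term leNgt xy.
  rewrite /prop_for /continuous_at yE; apply: cvg_near_cst; near=> z.
  rewrite /cos_term leNgt ifF//.
  by apply/negbTE; rewrite negbK; near: z; exact: lt_nbhsr.
have yE : cos_term x t y = cos (t * ln y) by rewrite /cos_term (ltW yx).
rewrite /prop_for /continuous_at yE.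
(* For [y < 0] the convention that [ln] vanishes there makes the term locally constant. *)
have {y0} [y0|y0] : y < 0 \/ 0 < y by apply/orP; rewrite -neq_lt.
- rewrite (ln0 (ltW y0)); apply: cvg_near_cst; near=> z.
  rewrite /cos_term ifT ?ln0//.
    by apply/ltW; near: z; exact: lt_nbhsl.
  by apply/ltW; near: z; exact: lt_nbhsl.
apply: (@cvg_trans _ (cos (t * ln z) @[z --> y])); last first.
  apply: (continuous_comp (f := fun z => t * ln z)); last exact: continuous_cos.
  by apply: cvgM; [exact: cvg_cst|exact: continuous_ln].
apply: near_eq_cvg; near=> z; rewrite /cos_term ifT//.
by apply/ltW; near: z; exact: lt_nbhsl.
Unshelve. all: by end_near. Qed.

Lemma Re_nit_sum_continuous N x t :
  (exists K, forall i, (K <= i)%N -> x < a i) ->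
  (forall i, set_val (N i) != 0 /\ set_val (N i) != x) ->
  complex.Re (nit_sum M x t) @[M --> N] --> complex.Re (nit_sum N x t).
Proof.
move=> [K Kx] N0x; under eq_fun do rewrite (Re_nit_sum _ _ Kx).
rewrite (Re_nit_sum _ _ Kx); apply: cvg_big => [||i _].
- exact: add_continuous.
- exact: (@nbhs_filter (seq_box a b)).
have [N0 Nx] := N0x i.
apply: (continuous_comp (f := fun M : seq_box a b => set_val (M i)));
  [exact: box_coord_continuous | exact: cos_term_continuous].
Qed.

End cosine_sum.

(** * Choice of points and growth estimates *)

(** The interval starts or ends at [n], on a side where at least half of [[a, b]] remains; it fits
    because [d <= 1/2]. *)
Lemma subinterval_near (R : realType) (a b n d : R) :
  a <= n <= b -> 0 <= d <= 2^-1 ->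
  exists u, [/\ a <= u, u + d * (b - a) <= b &
    forall y, u <= y <= u + d * (b - a) -> `|n - y| <= d * (b - a)].
Proof.
move=> /andP[an nb] /andP[d0 d2].
have dl : 0 <= d * (b - a) <= (b - a) / 2.
  rewrite mulr_ge0 ?subr_ge0 ?(le_trans an)//= mulrC ler_wpM2l//.
  by rewrite subr_ge0 (le_trans an).
have [h|h] := leP (n - a) ((b - a) / 2).
  by exists n; split=> [||y]; rewrite ?ler_norml; lra.
by exists (n - d * (b - a)); split=> [||y]; rewrite ?ler_norml; lra.
Qed.

(** Two forbidden values cannot exclude all of [u], the midpoint and [v]. *)
Lemma exists_avoiding2 (R : realType) (u v p q : R) : u < v ->
  exists y, [/\ u <= y <= v, y != p & y != q].
Proof.
move=> uv; pose m := (u + v) / 2.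
have um : u < m by rewrite /m; lra.
have mv : m < v by rewrite /m; lra.
have [up|up] := eqVneq u p; have [uq|uq] := eqVneq u q;
  have [mp|mp] := eqVneq m p; have [mq|mq] := eqVneq m q;
  solve [exists u; split=> //; lra | exists m; split=> //; lra
    | exists v; split; [lra|apply/eqP; lra|apply/eqP; lra]].
Qed.

Lemma near_equiv_ge (R : realType) (a : nat -> R) (A : R) :
  a i / i.+1%:R @[i --> \oo] --> (1 : R) -> \forall i \near \oo, A <= a i.
Proof.
move=> ha; near=> i.
have : 2^-1 < a i / i.+1%:R by near: i; apply: (cvgr_gt 1) => //; lra.
rewrite ltr_pdivlMr// => ai.
have : 2 * A <= i%:R by near: i; exact: nbhs_infty_ger.
by move: ai; rewrite -(natr1 i); lra.
Unshelve. all: by end_near. Qed.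

(** With [m] the first tuned index, this says that the [i - m] tuned terms outnumber [eta * x] at
    [x = b i]. *)
Lemma near_equiv_lt (R : realType) (b : nat -> R) (m : nat) (eta : R) :
  0 <= eta < 1 -> b i / i.+1%:R @[i --> \oo] --> (1 : R) ->
  \forall i \near \oo, eta * b i < i%:R - m%:R.
Proof.
move=> /andP[eta0 eta1] hb; near=> i.
have : b i / i.+1%:R < 1 + (1 - eta) / 2.
  by near: i; apply: (cvgr_lt 1) => //; lra.
rewrite ltr_pdivrMr// => bi.
have : 2 * (m%:R + 2) / (1 - eta) <= i%:R.
  by near: i; exact: nbhs_infty_ger.
rewrite ler_pdivrMr ?subr_gt0// => mi.
have : eta * b i <= eta * ((1 + (1 - eta) / 2) * i.+1%:R).
  by rewrite ler_wpM2l// ltW.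
(* The factor [(1 + eta) / 2] is still below 1, which leaves room for the constant [m]. *)
have : eta * (1 + (1 - eta) / 2) * i.+1%:R <= (1 + eta) / 2 * i.+1%:R.
  by rewrite ler_wpM2r//; nra.
by rewrite -(natr1 i); lra.
Unshelve. all: by end_near. Qed.

Lemma powR_large (R : realType) (p B : R) : 0 < p ->
  exists W : R, forall x, W <= x -> B <= x `^ p.
Proof.
move=> p0; exists (Num.max B 0 `^ p^-1) => x Wx.
have B0 : 0 <= Num.max B 0 by rewrite le_max lexx orbT.
apply: le_trans (_ : Num.max B 0 <= _); first by rewrite le_max lexx.
rewrite -[leLHS]powRr1// -(mulVf (lt0r_neq0 p0)) powRrM.
apply: ge0_ler_powR; rewrite ?nnegrE ?powR_ge0// ?(ltW p0)//.
by rewrite (le_trans _ Wx)// powR_ge0.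
Qed.

(** * Breaking the inequality near an arbitrary sequence *)

Section escape.
Context (R : realType) (a b : nat -> R).
Context (b_incr : increasing_seq b) (ab : forall i, a i < b i).
Context (a_equiv : a i / i.+1%:R @[i --> \oo] --> (1 : R)).
Context (b_equiv : b i / i.+1%:R @[i --> \oo] --> (1 : R)).
Context (ab_gap : gap_bounded_below a b).

(** The angle [s] is a parameter so that the sequences for [s = 0] and [s = pi] share all untuned
    terms. Tuning starts at [j0], where [1 <= a i] makes [cos_ln_attained] applicable. *)
Lemma tuned_box (N : seq_box a b) (d x t : R) (j0 n : nat) :
  0 < d <= 2^-1 -> 0 < t ->
  (forall i, (j0 <= i)%N -> 1 <= a i) ->
  (forall i, (i < n)%N -> b i < x) ->
  (forall i, pi *+ 2 * x <= t * (d * (b i - a i))) ->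
  exists M : R -> seq_box a b, [/\
    forall s, s <= pi *+ 2 -> box_dist N (M s) <= d,
    forall s i, s <= pi *+ 2 -> set_val (M s i) != 0 /\ set_val (M s i) != x,
    forall s i, s <= pi *+ 2 -> (j0 <= i < n)%N ->
      cos (t * ln (set_val (M s i))) = cos s &
    forall s s' i, ~~ (j0 <= i < n)%N -> M s i = M s' i].
Proof.
move=> /andP[d0 d2] t0 a1 bx tx.
have gap0 i : 0 < b i - a i by rewrite subr_gt0.
have dgap0 i : 0 < d * (b i - a i) by rewrite mulr_gt0.
have /choice[u /all_and3[au ub Nu]] i :=
  subinterval_near (box_itv N i) (introT andP (conj (ltW d0) d2)).
have /choice[w /all_and3[uw w0 wx]] i :
    exists y, [/\ u i <= y <= u i + d * (b i - a i), y != 0 & y != x].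
  by apply: exists_avoiding2; rewrite ltrDl.
(* Outside the range of tuning, [u i] is a dummy value. *)
have /choice[v vP] (si : R * nat) : exists y,
    u si.2 <= y <= u si.2 + d * (b si.2 - a si.2) /\
    (si.1 <= pi *+ 2 -> (j0 <= si.2 < n)%N -> cos (t * ln y) = cos si.1).
  case: si => s i /=; have [/andP[ji ni]|ni] := boolP (j0 <= i < n)%N;
    last first.
    by exists (u i); split => //; rewrite lexx lerDl ltW.
  have [s2|s2] := leP s (pi *+ 2); last first.
    by exists (u i); split => //; rewrite lexx lerDl ltW.
  have u1 : 1 <= u i := le_trans (a1 _ ji) (au i).
  have uv : u i <= u i + d * (b i - a i) by rewrite lerDl ltW.
  have tuv : pi *+ 2 * (u i + d * (b i - a i)) <=
      t * (u i + d * (b i - a i) - u i).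
    rewrite [_ - u i]addrAC subrr add0r; apply: le_trans (tx i).
    have p0 : 0 < pi *+ 2 :> R by rewrite mulrn_wgt0// pi_gt0.
    rewrite ler_pM2l//.
    exact: ltW (le_lt_trans (ub i) (bx _ ni)).
  have [y uyv yE] := cos_ln_attained u1 uv t0 tuv s2.
  by exists y.
pose f s i := if (j0 <= i < n)%N then v (s, i) else w i.
have uf s i : u i <= f s i <= u i + d * (b i - a i).
  by rewrite /f; case: ifP => // _; have [] := vP (s, i).
have fP s i : `[a i, b i]%classic (f s i).
  rewrite /= in_itv/=; have /andP[uf1 uf2] := uf s i.
  by rewrite (le_trans (au i))// (le_trans uf2).
exists (fun s i => exist _ (f s i) (mem_set (fP s i))); split.
- by move=> s s2; apply: box_dist_le => // i; apply: Nu; exact: uf.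
(* Tuned terms lie in [[1, b i]] with [b i < x], so they avoid 0 and [x]; the others do so by the
   choice of [w]. *)
- move=> s i s2; rewrite !set_valE /= /f; case: ifPn => // /andP[ji ni].
  have [/andP[uv vu] _] := vP (s, i); split.
    rewrite gt_eqF// (lt_le_trans ltr01)// (le_trans (a1 _ ji))//.
    exact: le_trans (au i) uv.
  by rewrite lt_eqF// (le_lt_trans vu)// (le_lt_trans (ub i))// bx.
- move=> s i s2 ijn; rewrite set_valE /= /f ijn.
  by have [_ ->] := vP (s, i).
- move=> s s' i ijn; apply: val_inj => /=.
  by rewrite /f (negbTE ijn).
Qed.

Lemma escape_bound (c eta X : R) (f : R -> R) (N : seq_box a b) (e : R) :
  1 < c -> 0 <= eta < 1 -> 0 < e ->
  exists x, X <= x /\ exists2 M, box_dist N M < e & \forall P \near M,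
    eta * x < `|complex.Re (nit_sum P x (x `^ c)) - f x|.
Proof.
move=> c1 eta01 e0; have [g g0 gab] := ab_gap.
(* Half of [e] gives the strict bound on the distance; the cap [1/2] is what [subinterval_near]
   requires. *)
pose d : R := Num.min (e / 2) 2^-1.
have d0 : 0 < d by rewrite lt_min divr_gt0//=; lra.
have d2 : 0 < d <= 2^-1 by rewrite d0 ge_min lexx orbT.
have de : d < e by rewrite gt_min; apply/orP; left; lra.
have [j0 _ a1] := near_equiv_ge 1 a_equiv.
(* Since [c > 1], [x ^ c / x] tends to infinity; beyond [W] every window, of length at least
   [d * g], holds a full turn. *)
have [W Wp] := @powR_large R (c - 1) (pi *+ 2 / (d * g)) ltac:(lra).
have [n [bn1 bnX bnW jn nj0]] : exists n, [/\ 1 <= b n, X <= b n, W <= b n,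
    (j0 <= n)%N & eta * b n < n%:R - j0%:R].
  near \oo => n; exists n; split.
  - by near: n; exact: near_equiv_ge.
  - by near: n; exact: near_equiv_ge.
  - by near: n; exact: near_equiv_ge.
  - by near: n; exact: nbhs_infty_ge.
  - by near: n; exact: near_equiv_lt.
set x := b n in bn1 bnX bnW nj0.
have x0 : 0 < x := lt_le_trans ltr01 bn1.
have t0 : 0 < x `^ c by rewrite powR_gt0.
have tE : x `^ c = x * x `^ (c - 1).
  rewrite -[X in X * _](powRr1 (ltW x0)) -powRD.
    by congr (_ `^ _); ring.
  by rewrite (gt_eqF x0) implybT.
have tx i : pi *+ 2 * x <= x `^ c * (d * (b i - a i)).
  rewrite tE mulrC -mulrA ler_pM2l//.
  apply: le_trans (_ : x `^ (c - 1) * (d * g) <= _).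
    by rewrite -ler_pdivrMr ?mulr_gt0// Wp.
  by rewrite ler_wpM2l ?powR_ge0// ler_pM2l.
have bx i : (i < n)%N -> b i < x.
  by move=> ni; rewrite ltNge b_incr -ltnNge.
have [M [NM M0x Mcos MM]] := tuned_box N d2 t0 a1 bx tx.
have [K0 _ K0x] := near_equiv_ge (x + 1) a_equiv.
(* Taking [K] at least [n] lets the sum be split at [j0] and [n]. *)
pose K := maxn K0 n.
have Kx i : (K <= i)%N -> x < a i.
  rewrite geq_max => /andP[/K0x/= h _]; apply: lt_le_trans h; lra.
have p2 : 0 <= pi *+ 2 :> R by rewrite mulrn_wge0// pi_ge0.
have pp2 : pi <= pi *+ 2 :> R by rewrite mulr2n lerDl pi_ge0.
have gap : complex.Re (nit_sum (M 0) x (x `^ c)) -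
    complex.Re (nit_sum (M pi) x (x `^ c)) = 2 * (n%:R - j0%:R).
  rewrite !(Re_nit_sum _ _ Kx) -sumrB.
  pose D i := cos_term x (x `^ c) (set_val (M 0 i)) -
    cos_term x (x `^ c) (set_val (M pi i)).
  have D0 i : ~~ (j0 <= i < n)%N -> D i = 0.
    by move=> ijn; rewrite /D (MM 0 pi i ijn) subrr.
  have D2 i : (j0 <= i < n)%N -> D i = 2.
    move=> ijn; have Mx s : set_val (M s i) <= x.
      have /andP[_ Mb] := box_itv (M s) i; apply: le_trans Mb _.
      by have /andP[_ /bx/ltW] := ijn.
    by rewrite /D /cos_term !Mx !Mcos// cos0 cospi opprK.
  rewrite -(big_mkord xpredT D).
  rewrite (@big_cat_nat _ _ _ n) ?leq_maxr//= (@big_cat_nat _ _ _ j0)//=.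
  rewrite (@big_nat_cond _ _ _ 0 j0) big1 =>
      [|i /andP[/andP[_ ij] _]]; last first.
    by rewrite D0// negb_and -ltnNge ij.
  rewrite (@big_nat_cond _ _ _ n K) [X in _ + X]big1 =>
      [|i /andP[/andP[ni _] _]]; last first.
    by rewrite D0// negb_and -!ltnNge ltnS ni orbT.
  rewrite add0r addr0 (eq_big_nat _ _ D2) sumr_const_nat -natrB//.
  by rewrite mulr_natr.
have [s [s2 sf]] : exists s, s <= pi *+ 2 /\
    eta * x < `|complex.Re (nit_sum (M s) x (x `^ c)) - f x|.
  have [h|h] := ltP (eta * x) `|complex.Re (nit_sum (M 0) x (x `^ c)) - f x|.
    by exists 0.
  (* Were both sums within [eta * x] of [f x], their difference [2 * (n - j0)] would be at most
     [2 * eta * x], against [nj0]. *)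
  exists pi; split => //; rewrite ltNge; apply/negP.
  by move: h; rewrite !ler_norml; lra.
exists x; split => //; exists (M s); first exact: le_lt_trans (NM s s2) de.
have Mfilter : Filter (nbhs (M s)) by exact: (@nbhs_filter (seq_box a b)).
have cvgS : `|complex.Re (nit_sum P x (x `^ c)) - f x| @[P --> M s] -->
    `|complex.Re (nit_sum (M s) x (x `^ c)) - f x|.
  apply: cvg_norm; apply: cvgB; last exact: cvg_cst.
  by apply: Re_nit_sum_continuous; [exists K|move=> i; exact: M0x].
exact: (cvgr_gt _ cvgS _ sf).
Unshelve. all: by end_near. Qed.

End escape.

(** * The countable cover of [Y F] *)

Theorem theorem2p5 (R : realType) (a b : nat -> R)
  (a_incr : increasing_seq a) (b_incr : increasing_seq b)
  (ab : forall i, a i < b i)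
  (a_equiv : a i / i.+1%:R @[i --> \oo] --> (1 : R))
  (b_equiv : b i / i.+1%:R @[i --> \oo] --> (1 : R))
  (ab_gap : gap_bounded_below a b)
  (F : R -> R -> R[i]) (F_rc : right_continuous_fst F) :
  meagre (Y F : set (seq_box a b)) /\
  meagre (Y F : set (metric_box ab)).
Proof.
pose r k : R := k.+1%:R^-1.
pose c k : R := 1 + r k; pose eta k : R := 1 - r k.
(* One index [k] replaces [x0], [c2] and [eta] at once, and only [t = x ^ c k] is tested; a large
   [k] gives [x0 <= k + 1], [c k < c2] and [e < eta k]. *)
pose B k := [set N : seq_box a b | forall x : R, k.+1%:R <= x ->
  `|nit_sum N x (x `^ c k) - F x (x `^ c k)| <= (eta k * x)%:C].
apply: (@meagre_box _ _ _ ab _ B) => [N [x0 [c1 [c2 [e]]]]|k N e e0].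
  move=> [x01 /andP[c10 c11] c21 /andP[e0 e1] NF].
  have c20 : 0 < c2 - 1 by lra.
  have e10 : 0 < 1 - e by lra.
  near \oo => k; exists k => // x kx.
  have k0 : 0 < r k by rewrite invr_gt0.
  have kc : r k < c2 - 1.
    by near: k; exact: (near_infty_natSinv_lt (PosNum c20)).
  have ke : r k < 1 - e.
    by near: k; exact: (near_infty_natSinv_lt (PosNum e10)).
  have x0x : x0 <= x.
    apply: le_trans kx; apply: le_trans (_ : k%:R <= _);
      last by rewrite ler_nat.
    by near: k; exact: nbhs_infty_ger.
  have x1 : 1 <= x by lra.
  apply: le_trans (_ : (e * x)%:C <= _).
    apply: NF => //; rewrite ger0_norm ?powR_ge0//.
    by apply/andP; split; apply: ler_powR => //; rewrite /c; lra.
  by rewrite lecR; apply: ler_wpM2r; rewrite /eta; lra.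
have k0 : 0 < r k by rewrite invr_gt0.
have k1 : r k <= 1 by rewrite invf_le1// ler1n.
have [||x [kx [M NM MF]]] := @escape_bound _ _ _
  b_incr ab a_equiv b_equiv ab_gap (c k) (eta k) k.+1%:R
  (fun x => complex.Re (F x (x `^ c k))) N e _ _ e0.
- by rewrite /c; lra.
- by rewrite /eta; lra.
(* The modulus dominates the real part, so a violation by real parts excludes membership in
   [B k]. *)
exists M => //; apply: filterS MF => P PF /(_ x kx) /(le_trans (normc_ge_Re _)).
by rewrite lecR leNgt raddfB PF.
Unshelve. all: by end_near. Qed.
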